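(* Let $G$ be a connected hypergraph. Then the following are equivalent: (1) $G$ is odd-bipartite. (2) $\mathcal{A}_G$ and $-\mathcal{A}_G$ have the same spectrum and H-spectrum. (3) $-\rho(\mathcal{A}_G)$ is an H-eigenvalue of $\mathcal{A}_G$.
   Context: A (finite) hypergraph $H$ has vertex set $V(H)$ and edge set $E(H)$, a set of nonempty subsets of $V(H)$, with at least one edge (so that the rank is defined). The rank $r(H)$ is the maximum cardinality of an edge. A path of length $l$ is an alternating sequence $u_1e_1u_2\cdots u_le_lu_{l+1}$ with distinct vertices $u_1,\ldots,u_{l+1}$ and distinct edges $e_1,\ldots,e_l$ such that $u_i,u_{i+1}\in e_i$ for all $i$; $H$ is connected if there is a path between any two vertices. $H$ is odd-bipartite if its vertex set has a partition $V(H)=V_1\cup V_2$ such that each edge of $H$ contains an odd number of vertices in $V_1$ and an odd number of vertices in $V_2$. The adjacency tensor $\mathcal{A}_H=(a_{i_1\cdots i_k})$ of a hypergraph $H$ with $r(H)=k$ is the order $k$, dimension $|V(H)|$ symmetric tensor with $a_{i_1\cdots i_k}=\frac{1}{(k-1)!}$ if $\{i_1,\ldots,i_k\}$ is an edge of cardinality $k$; $a_{i_1\cdots i_k}=\frac{(k-s+1)!}{k!}$ if, as a multiset, $\{i_1,\ldots,i_k\}$ consists of $j_1$ with multiplicity $k-s+1$ and $j_2,\ldots,j_s$ each with multiplicity one, for some edge $\{j_1,\ldots,j_s\}\in E(H)$ of cardinality $s<k$ (any element of the edge may play the role of $j_1$); and $a_{i_1\cdots i_k}=0$ otherwise. For an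 order $m$ dimension $n$ tensor $\mathcal{A}=(a_{i_1\cdots i_m})$ and $x\in\mathbb{C}^n$, $\mathcal{A}x^{m-1}\in\mathbb{C}^n$ has $i$-th component $\sum_{i_2,\ldots,i_m=1}^n a_{ii_2\cdots i_m}x_{i_2}\cdots x_{i_m}$. A number $\lambda\in\mathbb{C}$ is an eigenvalue of $\mathcal{A}$ with eigenvector $x$ if $x\in\mathbb{C}^n$ is nonzero and $\mathcal{A}x^{m-1}=\lambda x^{[m-1]}$, where $x^{[m-1]}=(x_1^{m-1},\ldots,x_n^{m-1})^{\mathrm T}$. A real eigenvalue having a real eigenvector is an H-eigenvalue. The spectrum of $\mathcal{A}$ is the set of all its eigenvalues, the H-spectrum is the set of all its H-eigenvalues, and the spectral radius is $\rho(\mathcal{A})=\max\{|\lambda|:\lambda \text{ an eigenvalue of }\mathcal{A}\}$. *)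

(* Defs.v *)
From mathcomp Require Import all_boot all_order all_algebra.
From mathcomp Require Import all_classical all_reals.
From mathcomp Require Export complex.

Set Implicit Arguments.
Unset Strict Implicit.
Unset Printing Implicit Defensive.

Import Order.TTheory GRing.Theory Num.Theory.
Local Open Scope ring_scope.
Local Open Scope complex_scope.

Record hypergraph (V : finType) := Hypergraph {
  edges :> {set {set V}};
  edges_nonempty : finset.set0 \notin edges;
  has_edge : edges != finset.set0
}.

Section Hypergraph.
Variables (V : finType) (H : hypergraph V).

Definition rank : nat := \max_(e in edges H) #|e|.

(* The alternating sequence u_1 e_1 u_2 ... e_l u_{l+1} is encoded by its first
   vertex u_1 and the sequence [:: (e_1, u_2); ...; (e_l, u_{l+1})]. *)
Fixpoint walk (u : V) (p : seq ({set V} * V)) : bool :=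
  if p is (e, v) :: p' then
    [&& e \in edges H, u \in e, v \in e & walk v p']
  else true.

Definition is_path (u : V) (p : seq ({set V} * V)) : bool :=
  [&& walk u p, uniq (u :: unzip2 p) & uniq (unzip1 p)].

Definition connected : Prop :=
  forall u v : V, exists2 p, is_path u p & last u (unzip2 p) = v.

Definition odd_bipartite : Prop :=
  exists V1 V2 : {set V},
    [/\ V1 :|: V2 = [set: V], [disjoint V1 & V2] &
        forall e, e \in edges H -> odd #|e :&: V1| /\ odd #|e :&: V2| ].

End Hypergraph.

(* A tensor of order m and dimension #|I| is a function of m-tuples of indices in
   I.  The i-th component of A x^(m-1), a sum over (i_2, ..., i_m), is written as
   a sum over the m-tuples whose first entry is i. *)
Definition tensor_app (K : fieldType) (m : nat) (I : finType)
    (A : {ffun m.-tuple I -> K}) (x : {ffun I -> K}) : {ffun I -> K} :=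
  [ffun i => \sum_(t : m.-tuple I | ohead t == Some i)
               A t * \prod_(j <- behead t) x j].

Definition eigenpair (K : fieldType) (m : nat) (I : finType)
    (A : {ffun m.-tuple I -> K}) (lambda : K) (x : {ffun I -> K}) : Prop :=
  x != 0 /\ tensor_app A x = [ffun i => lambda * x i ^+ m.-1].

Section Spectrum.
Variables (R : realType) (m : nat) (I : finType).
Implicit Type A : {ffun m.-tuple I -> R[i]}.

Definition spectrum A : set R[i] :=
  [set lambda | exists x, eigenpair A lambda x]%classic.

Definition Hspectrum A : set R[i] :=
  [set lambda | lambda \is Num.real /\
     exists2 x : {ffun I -> R[i]},
       eigenpair A lambda x & forall i, x i \is Num.real]%classic.

Definition moduli A : set R :=
  [set complex.Re `|lambda| | lambda in spectrum A]%classic.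

Definition spectral_radius A : R := sup (moduli A).

(* The supremum is the maximum modulus as soon as the latter exists. *)
Lemma spectral_radius_max A (r : R) :
  moduli A r -> ubound (moduli A) r -> spectral_radius A = r.
Proof.
move=> Ar ubr; apply/le_anti/andP; split; first by apply: ge_sup => //; exists r.
by apply: ub_le_sup => //; exists r.
Qed.

End Spectrum.

(* The support of the index tuple t is the only edge that t can come from.  If
   it is an edge of cardinality s < k, the entry is nonzero exactly when t is,
   as a multiset, made of one vertex of the edge with multiplicity k - s + 1 and
   of the others with multiplicity 1. *)
Definition adjacency_tensor (R : realType) (V : finType) (H : hypergraph V) :
    {ffun (rank H).-tuple V -> R[i]} :=
  [ffun t : (rank H).-tuple V =>
    let k := rank H in
    let e := [set v in tval t]%SET in
    let s := #|e| in
    if e \notin edges H then 0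
    else if s == k then 1 / ((k.-1)`!)%:R
    else if [exists j in e, perm_eq t (nseq (k - s).+1 j ++ enum (e :\ j)%SET)]
    then ((k - s).+1`!)%:R / (k`!)%:R
    else 0].

(* Main.v *)
From mathcomp Require Import perm topology normedtype derive realfun ring lra.
Require Import Defs.
From mathcomp Require Import all_boot all_order all_algebra.
From mathcomp Require Import all_classical all_reals.

(** The theorem is an instance of a statement about every tensor A that is
    entrywise nonnegative, symmetric and weakly irreducible; the only fact
    special to hypergraphs is a parity computation.

    Let F(y) be the sum of A_t y_{t_1} ... y_{t_m} over all index words t, and
    S(y) the sum of the y_i^m, for y >= 0.  Since F / S is homogeneous of degree
    0, its maximum rho is attained by compactness of the standard simplex
    ([exists_maximizer]).  Weak irreducibility forces every maximizer to be
    positive: raising all zero coordinates to e costs rho * #Z * e^m but gains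
    at least a multiple of e^(m-1) ([maximizer_gt0]).  At a positive maximizer
    all partial derivatives of rho * S - F vanish, which for a symmetric tensor
    is the eigenvalue equation ([maximizer_critical]).  The triangle inequality
    bounds every other eigenvalue by rho ([eigenvalue_le_maximum]).  So rho is
    the spectral radius and an H-eigenvalue.

    In the eigenvalue equation the i-th coordinate, multiplied by x_i, says that
    the sum of A_t x_{t_1} ... x_{t_m} over the words t starting with i is
    lambda x_i^m.  Negating the coordinates in a set Z multiplies the term of t
    by the sign (-1)^(number of letters of t in Z), and the right-hand side by
    (-1)^m if i is in Z.  If these signs always disagree on the nonzero entries, Z is called
    a skew signing, and flipping signs along Z exchanges the eigenpairs of A and
    of - A ([skew_signing_spectrum]).  Conversely, let x be a real eigenvector
    for - rho.  Then |x| maximizes F / S, hence is positive, and the triangle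
    inequality is an equality in every coordinate; this says exactly that the
    negative coordinates of x form a skew signing
    ([skew_signing_of_Hspectrum]).

    For an adjacency tensor of order k, the words with nonzero entry are, up to
    order, an edge e with one vertex repeated k - #e extra times.  Counting
    letters modulo 2 shows that the skew signings are the odd bipartitions
    ([odd_bipartite_skew_signing], [skew_signing_odd_bipartite]). *)

Set Implicit Arguments.
Unset Strict Implicit.
Unset Printing Implicit Defensive.

Import Order.TTheory GRing.Theory Num.Theory.
Import numFieldNormedType.Exports.
Local Open Scope ring_scope.
Local Open Scope complex_scope.

(** * The form of a tensor *)

Section Form.
Variables (K : comNzRingType) (m : nat) (I : finType).
Implicit Types (a : m.-tuple I -> K) (x : I -> K).

Definition tensor_form a x : K := \sum_t a t * \prod_(j <- t) x j.

(** This is [x i] times the [i]-th component of A x^(m-1).  As all letters of the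
    word occur in the product, a symmetric [a] gives terms invariant under
    permutations of the word. *)
Definition tensor_slice a x (i : I) : K :=
  \sum_(t : m.-tuple I | ohead t == Some i) a t * \prod_(j <- t) x j.

Definition power_sum x : K := \sum_i x i ^+ m.

Definition perm_invariant {T : Type} (w : m.-tuple I -> T) : Prop :=
  forall t u : m.-tuple I, perm_eq t u -> w t = w u.

Lemma tensor_form_slices a x :
  (0 < m)%N -> tensor_form a x = \sum_i tensor_slice a x i.
Proof.
move=> m_gt0; rewrite /tensor_form.
have [i0 _|I0] := pickP I; last first.
  rewrite big1 ?big1 // => [i|t]; first by have := I0 i.
  by have := I0 (tnth t (Ordinal m_gt0)).
rewrite (partition_big (fun t : m.-tuple I => head i0 t) xpredT) //=.
apply: eq_bigr => i _; rewrite /tensor_slice; apply: eq_bigl => t.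
have: size t != 0 by rewrite size_tuple -lt0n.
by case: (tval t).
Qed.

Lemma prod_scale (y : I -> K) (i : I) (c : K) (s : seq I) :
  \prod_(j <- s) (if j == i then c * y j else y j) =
  c ^+ count_mem i s * \prod_(j <- s) y j.
Proof.
elim: s => [|j s IHs]; first by rewrite !big_nil mulr1.
rewrite !big_cons IHs /=; case: eqP => _; last by rewrite add0n mulrCA.
by rewrite exprS -!mulrA; congr (_ * _); rewrite mulrCA.
Qed.

(** Each of the [m] positions contributes the same amount, since swapping it
    with the first position is a bijection of words which preserves [w]. *)
Lemma sum_count_perm_invariant (w : m.-tuple I -> K) (i : I) :
  perm_invariant w -> (0 < m)%N ->
  \sum_t w t *+ count_mem i t =
  (\sum_(t : m.-tuple I | ohead t == Some i) w t) *+ m.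
Proof.
move=> w_sym m_gt0; pose o := Ordinal m_gt0.
have countE (t : m.-tuple I) : count_mem i t = (\sum_(l < m) (tnth t l == i))%N.
  by rewrite -sum1_count big_mkcond big_tuple; apply: eq_bigr => l _ /=;
    case: eqP.
under eq_bigr do rewrite countE -sumrMnr.
rewrite exchange_big /=.
transitivity (\sum_(l < m) \sum_(t : m.-tuple I | ohead t == Some i) w t);
  last by rewrite sumr_const card_ord.
apply: eq_bigr => l _.
pose h (t : m.-tuple I) := [tuple tnth t (tperm o l j) | j < m].
have hK : involutive h.
  by move=> t; apply: eq_from_tnth => j; rewrite !tnth_mktuple tpermK.
rewrite (reindex_inj (inv_inj hK)) [RHS]big_mkcond /=.
apply: eq_bigr => t _; rewrite tnth_mktuple tpermR.
have -> : w (h t) = w t.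
  by apply: w_sym; apply/tuple_permP; exists (tperm o l).
have -> : ohead t = Some (tnth t o).
  have: size t != 0 by rewrite size_tuple -lt0n.
  by rewrite (tnth_nth (tnth t o)) /=; case: (tval t).
rewrite (inj_eq Some_inj).
by case: eqP.
Qed.

End Form.

(** * Maximizers of the form *)

Section Extremal.
Variables (R : realType) (m : nat) (I : finType) (a : m.-tuple I -> R).
Hypothesis m_gt0 : (0 < m)%N.
Implicit Types (x y : I -> R) (rho : R).

Lemma tensor_form_scale (c : R) x :
  tensor_form a (fun i => c * x i) = c ^+ m * tensor_form a x.
Proof.
rewrite /tensor_form mulr_sumr; apply: eq_bigr => t _.
by rewrite big_split /= big_const_seq count_predT size_tuple iter_mulr_1 mulrCA.
Qed.

Lemma power_sum_scale (c : R) x :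
  power_sum m (fun i => c * x i) = c ^+ m * power_sum m x.
Proof.
by rewrite /power_sum mulr_sumr; apply: eq_bigr => i _; rewrite exprMn.
Qed.

Lemma power_sum_gt0 x i : (forall j, 0 <= x j) -> x i != 0 -> 0 < power_sum m x.
Proof.
move=> x0 xi; rewrite /power_sum (bigD1 i) //= ltr_pwDl //.
  by rewrite exprn_gt0 // lt_neqAle eq_sym xi x0.
by rewrite sumr_ge0 // => j _; rewrite exprn_ge0.
Qed.

(** On nonnegative vectors, the quotient of the form by the power sum has
    maximum [rho], reached at [y]; its denominator has been cleared. *)
Definition maximizes rho y : Prop :=
  [/\ forall i, 0 <= y i, tensor_form a y = rho * power_sum m y &
      forall x, (forall i, 0 <= x i) -> tensor_form a x <= rho * power_sum m x].

(** The quotient has degree 0, so that the unit simplex may replace the sphere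
    of the m-norm: normalizing a vector then needs no m-th roots. *)
Lemma exists_maximizer (i0 : I) :
  exists rho y, maximizes rho y /\ exists i, y i != 0.
Proof.
pose T := prod_topology (fun _ : I => R : topologicalType).
pose simplex : set T :=
  [set x | (forall i, `[0, 1]%classic (x i)) /\ \sum_i x i = 1]%classic.
have proj_cont (i : I) : continuous (fun x : T => x i : R).
  exact: (@proj_continuous I (fun=> R) i).
have sum_cont (f : I -> T -> R) :
    (forall i, continuous (f i)) -> continuous (fun x : T => \sum_i f i x).
  by move=> fc; apply: (@continuous_big R) => //; exact: add_continuous.
have simplex_compact : compact simplex.
  apply: (@subclosed_compact T simplex
    [set x | forall i, `[0, 1]%classic (x i)]%classic).
  - have -> : simplex = ((\bigcap_(i in [set: I])
          (fun x : T => x i : R) @^-1` `[0, 1]%classic)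
        `&` (fun x : T => \sum_i x i) @^-1` [set 1])%classic.
      by apply/seteqP; split => x [x1 x2]; split => // i; [move=> _|];
        exact: x1.
    apply: closedI.
      apply: closed_bigI => i _; apply: preimage_closed => [x _|].
        exact: proj_cont.
      exact: interval_closed.
    by apply: preimage_closed => [x _|]; [exact: sum_cont | exact: closed_eq].
  - apply: (@tychonoff I (fun=> R) (fun=> `[0, 1]%classic)) => i.
    exact: segment_compact.
  - by move=> x [].
have power_sum_simplex x : simplex x -> 0 < power_sum m x.
  move=> [x01 x1].
  have [i xi|x0] := pickP (fun i => x i != 0).
    apply: (@power_sum_gt0 _ i) => // j; have := x01 j; rewrite /= in_itv /=.
    by case/andP.
  move: x1; rewrite big1 => [/esym/eqP|i _]; first by rewrite oner_eq0.
  by have /negbFE/eqP := x0 i.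
have simplex0 : (simplex !=set0)%classic.
  exists (fun i => (i == i0)%:R); split => [i|].
    by rewrite /= in_itv /=; case: eqP; rewrite ?ler01 ?lexx.
  by rewrite (bigD1 i0) //= eqxx big1 ?addr0 // => i /negPf ->.
have ratio_cont : {within simplex,
    continuous (fun x : T => tensor_form a x / power_sum m x)}%classic.
  apply: continuous_in_subspaceT => x /set_mem xS.
  apply: continuousM.
    apply: (@continuous_big R) => // [|t _]; first exact: add_continuous.
    move=> z; apply: continuousM; first exact: cst_continuous.
    by apply: (@continuous_big R) => //; exact: mul_continuous.
  apply: continuousV; first by rewrite gt_eqF // power_sum_simplex.
  apply: sum_cont => i z.
  apply: (@continuous_comp T R R (fun x => x i) (fun r => r ^+ m)).
    exact: proj_cont.
  exact: exprn_continuous.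
have [y /set_mem yS ymax] :=
  compact_EVT_max simplex0 simplex_compact ratio_cont.
exists (tensor_form a y / power_sum m y), y; split; last first.
  apply/not_existsP => y0; have := power_sum_simplex _ yS.
  rewrite /power_sum big1 ?ltxx // => i _.
  by have /negP := y0 i; rewrite negbK => /eqP ->; rewrite expr0n gtn_eqF.
have my := power_sum_simplex _ yS; split.
- by move=> i; case: yS => /(_ i); rewrite /= in_itv /= => /andP[].
- by rewrite divfK // gt_eqF.
move=> x x0; have [sx|sx] := eqVneq (\sum_i x i) 0.
  have xE : x = fun i => 0 * x i.
    apply/funext => i; rewrite mul0r.
    by apply: (psumr_eq0P _ sx).
  rewrite xE tensor_form_scale power_sum_scale expr0n gtn_eqF //.
  by rewrite !mul0r mulr0.
have s_gt0 : 0 < \sum_i x i by rewrite lt_neqAle eq_sym sx sumr_ge0.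
pose c := (\sum_i x i)^-1; have c_gt0 : 0 < c by rewrite invr_gt0.
have cxS : simplex (fun i => c * x i).
  split => [i|]; last by rewrite -mulr_sumr mulVf.
  rewrite /= in_itv /= mulr_ge0 ?(ltW c_gt0) //= mulrC ler_pdivrMr // mul1r.
  by rewrite (bigD1 i) //= lerDl sumr_ge0.
have := ymax _ (mem_set cxS).
rewrite ler_pdivrMr ?power_sum_simplex // tensor_form_scale power_sum_scale mulrCA.
by rewrite ler_pM2l // exprn_gt0.
Qed.

End Extremal.

(** Every cut of the index set is crossed by a nonzero entry: the graph joining
    two indices when some nonzero entry involves both is connected.  For a
    symmetric tensor this is the usual notion of weak irreducibility. *)
Definition weakly_irreducible (K : pzRingType) (m : nat) (I : finType)
    (a : m.-tuple I -> K) : Prop :=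
  forall Z : {set I}, (exists i, i \in Z) -> (exists i, i \notin Z) ->
  exists2 t, a t != 0 & has [in Z] t && ~~ all [in Z] t.

(** Along the scaling of one coordinate by [c > 0], the difference between [rho]
    times the power sum and the form is a polynomial in [c], minimal at [c = 1].
    Scaling rather than translating the coordinate keeps every monomial a power
    of [c], hence the derivative at 1 counts the occurrences of [i]. *)
Lemma maximizer_critical (R : realType) (m : nat) (I : finType)
    (a : m.-tuple I -> R) (rho : R) (y : I -> R) (i : I) :
    (0 < m)%N -> perm_invariant a -> maximizes a rho y ->
  y i != 0 -> tensor_slice a y i = rho * y i ^+ m.
Proof.
move=> m_gt0 a_sym [y0 fy ymax] yi.
pose w (t : m.-tuple I) := a t * \prod_(j <- t) y j.
have w_sym : perm_invariant w.
  by move=> t u tu; rewrite /w (a_sym _ _ tu) (perm_big _ tu).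
pose p : {poly R} := (rho * y i ^+ m) *: 'X^m +
  (rho * \sum_(j | j != i) y j ^+ m)%:P - \sum_t w t *: 'X^(count_mem i t).
pose z c j := if j == i then c * y j else y j.
have pE c : p.[c] = rho * power_sum m (z c) - tensor_form a (z c).
  rewrite /p !hornerE horner_sum /power_sum.
  rewrite [X in _ = rho * X - _](bigD1 i) //= {1}/z eqxx mulrDr.
  congr (_ + _ - _); first by rewrite exprMn; ring.
    by congr (_ * _); apply: eq_bigr => j /negPf ji; rewrite /z ji.
  apply: eq_bigr => t _; rewrite !hornerE /z prod_scale /w.
  by rewrite -!mulrA; congr (_ * _); rewrite mulrC.
have p1 : p.[1] = 0.
  have zE : z 1 = y.
    by apply/funext => j; rewrite /z mul1r if_same.
  by rewrite pE zE fy subrr.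
have p_ge0 c : 0 <= c -> 0 <= p.[c].
  move=> c0; rewrite pE subr_ge0; apply: ymax => j.
  by rewrite /z; case: ifP => _ //; rewrite mulr_ge0.
have : p^`().[1] = 0.
  have [_ <-] := is_derive_poly p 1.
  have [//|t _|||_ <-//] := @derive1_at_min R (horner p) 0 2 1.
  - exact: derivable_horner.
  - by rewrite in_itv /=; lra.
  - by move=> t; rewrite in_itv /= p1 => /andP[/ltW t0 _]; exact: p_ge0.
rewrite /p !poly.derivE raddf_sum !hornerE horner_sum /=.
under eq_bigr do
  rewrite poly.derivZ poly.derivXn hornerZ hornerMn hornerXn expr1n mulrnAr
    mulr1.
rewrite sum_count_perm_invariant // hornerMn hornerXn expr1n mulrnAr mulr1.
rewrite -mulrnBl => /eqP.
by rewrite mulrn_eq0 (gtn_eqF m_gt0) /= subr_eq0 => /eqP ->.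
Qed.

(** If [y] vanished exactly on a nonempty set [Z], give it the value [e] there.
    A word meeting both [Z] and its complement has at most [m - 1] letters in
    [Z], so the form gains at least [C * e ^+ m.-1], whereas the power sum gains
    only [#|Z| * e ^+ m]: a contradiction for small [e]. *)
Lemma maximizer_gt0 (R : realType) (m : nat) (I : finType)
    (a : m.-tuple I -> R) (rho : R) (y : I -> R) :
    (forall t, 0 <= a t) -> weakly_irreducible a -> maximizes a rho y ->
  (exists i, y i != 0) -> forall i, 0 < y i.
Proof.
move=> a0 a_irr [y0 fy ymax] [i1 yi1] i0.
rewrite lt_neqAle y0 andbT eq_sym; apply/negP => /eqP yi0.
pose Z := [set i | y i == 0]%SET.
have [||t0 at0 /andP[hasZ notZ]] := a_irr Z.
- by exists i0; rewrite inE yi0.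
- by exists i1; rewrite inE.
have Zt0 : (count [in Z] t0 < m)%N.
  move: notZ (count_size [in Z] t0); rewrite all_count size_tuple => ne le.
  by rewrite ltn_neqAle ne.
have m_gt0 : (0 < m)%N by exact: leq_ltn_trans Zt0.
pose C := a t0 * \prod_(j <- t0 | j \notin Z) y j.
have C_gt0 : 0 < C.
  rewrite mulr_gt0 ?lt_neqAle 1?eq_sym ?at0 ?a0 //.
  rewrite prodr_ge0 ?andbT // prodf_seq_neq0; apply/allP => j _.
  by rewrite inE; apply/implyP.
have perturb e : 0 < e -> e < 1 -> C <= rho * #|Z|%:R * e.
  move=> e_gt0 e_lt1; pose z i := if i \in Z then e else y i.
  have z0 i : 0 <= z i by rewrite /z; case: ifP => _; rewrite ?y0 ?ltW.
  have yz i : y i <= z i.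
    by rewrite /z inE; case: eqP => [->|_] //; exact: ltW.
  have pz : power_sum m z = power_sum m y + #|Z|%:R * e ^+ m.
    rewrite /power_sum (bigID [in Z]) /= [in RHS](bigID [in Z]) /=.
    rewrite [X in _ = X + _ + _]big1 ?add0r; last first.
      by move=> i; rewrite inE => /eqP ->; rewrite expr0n gtn_eqF.
    rewrite addrC; congr (_ + _).
      by apply: eq_bigr => i /negPf iZ; rewrite /z iZ.
    under eq_bigr do rewrite /z ifT //.
    by rewrite sumr_const mulr_natl.
  have fz : tensor_form a y + C * e ^+ m.-1 <= tensor_form a z.
    rewrite /tensor_form (bigD1 t0) //= [X in _ <= X](bigD1 t0) //=.
    rewrite addrAC; apply: lerD; last first.
      apply: ler_sum => t _; rewrite ler_wpM2l //; apply: ler_prod => i _.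
      by rewrite y0 yz.
    have -> : \prod_(j <- t0) y j = 0.
      apply/eqP; rewrite prodf_seq_eq0; apply/hasP.
      by case/hasP: hasZ => j jt; rewrite inE => yj; exists j.
    rewrite mulr0 add0r /C -mulrA ler_wpM2l //.
    rewrite [X in _ <= X](bigID [in Z]) /= mulrC.
    rewrite [X in _ <= _ * X](eq_bigr y); last first.
      by move=> j /negPf jZ; rewrite /z jZ.
    rewrite ler_wpM2r ?prodr_ge0 //.
    under eq_bigr do rewrite /z ifT //.
    rewrite big_const_seq iter_mulr_1 ler_wiXn2l ?(ltW e_gt0) ?(ltW e_lt1) //.
    by rewrite -ltnS prednK.
  have em : 0 < e ^+ m.-1 by rewrite exprn_gt0.
  rewrite -(ler_pM2r em) -[rho * _ * e * _]mulrA -exprS prednK //.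
  move: (le_trans fz (ymax z z0)).
  by rewrite pz mulrDr fy lerD2l mulrA.
pose D := rho * #|Z|%:R.
(* Taking e = 1 / 2 bounds C by D / 2, so that e = C / (2 * D) is also < 1. *)
have half := perturb (1 / 2) ltac:(lra) ltac:(lra).
have D_gt0 : 0 < D by rewrite /D; lra.
have D2_gt0 : 0 < 2 * D by lra.
have e_lt1 : C / (2 * D) < 1 by rewrite ltr_pdivrMr // /D; lra.
have := perturb _ (divr_gt0 C_gt0 D2_gt0) e_lt1; rewrite -/D.
have -> : D * (C / (2 * D)) = C / 2 by field; rewrite gt_eqF.
lra.
Qed.

(** * Eigenpairs and sign changes *)

Section Eigenpairs.
Variables (K : fieldType) (m : nat) (I : finType).
Variable A : {ffun m.-tuple I -> K}.
Implicit Types (lambda : K) (x : {ffun I -> K}).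

Lemma tensor_slice_app x i : tensor_slice A x i = x i * tensor_app A x i.
Proof.
rewrite /tensor_slice ffunE mulr_sumr; apply: eq_bigr => t.
case: (tval t) => [|j s] //=; rewrite (inj_eq Some_inj) => /eqP ->.
by rewrite big_cons mulrCA.
Qed.

Lemma eigenpair_slice lambda x i :
  (0 < m)%N -> eigenpair A lambda x -> tensor_slice A x i = lambda * x i ^+ m.
Proof.
move=> m_gt0 [_ /ffunP/(_ i)]; rewrite tensor_slice_app => ->.
by rewrite ffunE mulrCA -exprS prednK.
Qed.

(** The converse of [eigenpair_slice] divides by the coordinates of [x]. *)
Lemma slice_eigenpair lambda x (i0 : I) :
    (0 < m)%N -> (forall i, x i != 0) ->
    (forall i, tensor_slice A x i = lambda * x i ^+ m) ->
  eigenpair A lambda x.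
Proof.
move=> m_gt0 x_neq0 xE; split.
  by apply/eqP => /ffunP/(_ i0); rewrite ffunE; apply/eqP.
apply/ffunP => i; apply: (mulfI (x_neq0 i)).
by rewrite -tensor_slice_app xE ffunE mulrCA -exprS prednK.
Qed.

Lemma eigenpair_opp lambda x :
  eigenpair (- A) lambda x <-> eigenpair A (- lambda) x.
Proof.
have appN : tensor_app (- A) x = - tensor_app A x.
  apply/ffunP => i; rewrite !ffunE -sumrN; apply: eq_bigr => t _.
  by rewrite ffunE mulNr.
have vecN :
    [ffun i => - lambda * x i ^+ m.-1] = - [ffun i => lambda * x i ^+ m.-1].
  by apply/ffunP => i; rewrite !ffunE mulNr.
rewrite /eigenpair appN vecN; split=> -[x0 xE]; split => //.
  by rewrite -[LHS]opprK xE.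
by rewrite xE opprK.
Qed.

(** Negating the coordinates in [Z] multiplies the monomial of [t] by (-1) to
    the number of letters of [t] in [Z], and [x i ^+ m] by (-1)^m if [i] is in [Z]
    and 1 otherwise; these two signs are required to be opposite. *)
Definition skew_signing (Z : {set I}) : Prop :=
  forall (t : m.-tuple I) i, A t != 0 -> i \in tval t ->
  odd (count [in Z] t) = ~~ ((i \in Z) && odd m).

Definition sign_flip (Z : {set I}) x : {ffun I -> K} :=
  [ffun i => (-1) ^+ (i \in Z) * x i].

Lemma prod_sign_flip (Z : {set I}) x (s : seq I) :
  \prod_(j <- s) sign_flip Z x j = (-1) ^+ count [in Z] s * \prod_(j <- s) x j.
Proof.
elim: s => [|j s IHs]; first by rewrite !big_nil mulr1.
by rewrite !big_cons IHs ffunE /= exprD; ring.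
Qed.

Lemma eigenpair_sign_flip Z lambda x :
  (0 < m)%N -> skew_signing Z -> eigenpair A lambda x ->
  eigenpair A (- lambda) (sign_flip Z x).
Proof.
move=> m_gt0 Zskew [x0 /ffunP xE]; split.
  apply: contraNneq x0 => /ffunP fx0; apply/eqP/ffunP => i.
  by have /eqP := fx0 i; rewrite !ffunE mulf_eq0 signr_eq0 => /eqP.
apply/ffunP => i; have := xE i; rewrite !ffunE => {}xE.
(* The claim is now a comparison of signs, one word at a time. *)
transitivity (- (-1) ^+ ((i \in Z) * m.-1) * (lambda * x i ^+ m.-1));
  last first.
  by rewrite exprMn -exprM; ring.
rewrite -xE mulr_sumr; apply: eq_bigr => t ti.
have [-> | At] := eqVneq (A t) 0; first by rewrite !mul0r mulr0.
rewrite prod_sign_flip mulrCA; congr (_ * _).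
have it : i \in tval t.
  move: ti; case: (tval t) => //= j s; rewrite (inj_eq Some_inj) => /eqP ->.
  exact: mem_head.
have := Zskew t i At it.
have -> : odd m = ~~ odd m.-1 by rewrite -[in LHS](prednK m_gt0).
move: ti; case: (tval t) => //= j s; rewrite (inj_eq Some_inj) => /eqP ->.
rewrite oddD oddb => skew; rewrite -signr_odd -[in RHS]signr_odd oddM oddb.
move: skew; case: (i \in Z); case: (odd (count _ s)); case: (odd m.-1) => //= _;
  by rewrite ?expr1 ?expr0 ?opprK.
Qed.

End Eigenpairs.

Lemma skew_signing_spectrum (R : realType) (m : nat) (I : finType)
    (A : {ffun m.-tuple I -> R[i]}) (Z : {set I}) :
  (0 < m)%N -> skew_signing A Z ->
  spectrum A = spectrum (- A) /\ Hspectrum A = Hspectrum (- A).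
Proof.
move=> m_gt0 Zskew; split; apply/seteqP; split => lambda /=.
- case=> x Ax; exists (sign_flip Z x); apply/eigenpair_opp.
  exact: eigenpair_sign_flip.
- case=> x /eigenpair_opp Ax; exists (sign_flip Z x).
  by rewrite -[lambda]opprK; exact: eigenpair_sign_flip.
- case=> lr [x Ax xr]; split => //; exists (sign_flip Z x).
    by apply/eigenpair_opp; exact: eigenpair_sign_flip.
  by move=> i; rewrite ffunE rpredM ?xr // rpredX // rpredN rpred1.
- case=> lr [x /eigenpair_opp Ax xr]; split => //; exists (sign_flip Z x).
    by rewrite -[lambda]opprK; exact: eigenpair_sign_flip.
  by move=> i; rewrite ffunE rpredM ?xr // rpredX // rpredN rpred1.
Qed.

(** * Perron-Frobenius theory of symmetric tensors *)

Section Nonnegative.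
Variables (R : realType) (m : nat) (I : finType).
Variable A : {ffun m.-tuple I -> R[i]}.
Hypothesis m_gt0 : (0 < m)%N.
Hypothesis A_ge0 : forall t, 0 <= A t.

Definition real_entry (t : m.-tuple I) : R := complex.Re (A t).

Lemma real_entryE t : (real_entry t)%:C = A t.
Proof. by rewrite RRe_real // ger0_real. Qed.

Lemma real_entry_ge0 t : 0 <= real_entry t.
Proof. by rewrite -ler0c real_entryE. Qed.

Lemma real_tensor_slice (y : I -> R) i :
  tensor_slice A (fun j => (y j)%:C) i = (tensor_slice real_entry y i)%:C.
Proof.
rewrite /tensor_slice rmorph_sum; apply: eq_bigr => t _.
by rewrite rmorphM rmorph_prod /= real_entryE.
Qed.

(** By the triangle inequality, the vector of moduli of an eigenvector gives the
    quotient a value at least the modulus of the eigenvalue. *)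
Lemma eigenvalue_le_maximum rho y lambda x :
  maximizes real_entry rho y -> eigenpair A lambda x ->
  complex.Re `|lambda| <= rho.
Proof.
move=> [_ _ ymax] Ax; pose n i := complex.Re `|x i|.
have nE i : (n i)%:C = `|x i| by rewrite RRe_real // normr_real.
have n_ge0 i : 0 <= n i by rewrite -ler0c nE.
have [i xi] : exists i, n i != 0.
  apply/not_existsP => n0; case: Ax => /eqP []; apply/ffunP => i; rewrite ffunE.
  apply/normr0_eq0; rewrite -nE.
  by have /negP := n0 i; rewrite negbK => /eqP ->.
set l := complex.Re `|lambda|.
have lE : l%:C = `|lambda| by rewrite RRe_real // normr_real.
have le_slice j : l * n j ^+ m <= tensor_slice real_entry n j.
  rewrite -lecR -real_tensor_slice rmorphM rmorphXn /= nE lE.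
  rewrite -normrX -normrM -(eigenpair_slice _ m_gt0 Ax).
  rewrite (le_trans (ler_norm_sum _ _ _)) // ler_sum // => t _.
  by rewrite normrM ger0_norm // normr_prod ler_wpM2l.
rewrite -(ler_pM2r (power_sum_gt0 m n_ge0 xi)).
rewrite (le_trans _ (ymax n n_ge0)) // tensor_form_slices // mulr_sumr.
exact: ler_sum.
Qed.

Hypothesis A_sym : perm_invariant A.
Hypothesis A_irr : weakly_irreducible A.

Lemma real_entry_irreducible : weakly_irreducible real_entry.
Proof.
move=> Z Z0 Z1; have [t At tZ] := A_irr Z0 Z1; exists t => //.
by apply: contraNneq At => t0; rewrite -real_entryE t0.
Qed.

(** A maximizer is positive, hence an eigenvector for the maximum, which
    therefore is the largest modulus of an eigenvalue. *)
Lemma spectral_radius_maximum (i0 : I) : exists2 y : I -> R,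
  maximizes real_entry (spectral_radius A) y &
  Hspectrum A (spectral_radius A)%:C.
Proof.
have [rho [y [y_max y_neq0]]] := exists_maximizer real_entry m_gt0 i0.
have y_gt0 := maximizer_gt0 real_entry_ge0 real_entry_irreducible y_max y_neq0.
pose x := [ffun i => (y i)%:C].
have Ax : eigenpair A rho%:C x.
  apply: slice_eigenpair => // i; first by rewrite ffunE fmorph_eq0 gt_eqF.
  have -> : tensor_slice A x i = tensor_slice A (fun j => (y j)%:C) i.
    apply: eq_bigr => t _; congr (_ * _); apply: eq_bigr => j _.
    by rewrite ffunE.
  rewrite real_tensor_slice ffunE (maximizer_critical _ _ y_max) ?gt_eqF //.
    by rewrite rmorphM rmorphXn.
  by move=> t u tu; rewrite /real_entry (A_sym tu).
have rho_ge0 : 0 <= rho.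
  have := eigenvalue_le_maximum y_max Ax.
  by apply: le_trans; rewrite -ler0c RRe_real ?normr_real.
have -> : spectral_radius A = rho.
  apply: spectral_radius_max.
    by exists rho%:C; [exists x | rewrite ger0_norm ?ler0c].
  by move=> _ [lambda [z Az] <-]; exact: eigenvalue_le_maximum y_max Az.
exists y => //; split; first by rewrite ger0_real // ler0c.
by exists x => // i; rewrite ffunE ger0_real // ler0c; case: y_max.
Qed.

(** The moduli [n] of a real eigenvector [x] for [- rho] satisfy
    rho n_i^m <= slice_i(n) for all [i], while the sum over [i] of the
    right-hand sides is at most that of the left-hand sides.  So all are
    equalities, [n] is a maximizer, and no cancellation occurs in the slices of
    [x]: every nonzero monomial has the sign of - x_i^m. *)
Lemma skew_signing_of_Hspectrum (i0 : I) :
  Hspectrum A (- (spectral_radius A)%:C) -> exists Z, skew_signing A Z.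
Proof.
have [y [_ _ ymax] _] := spectral_radius_maximum i0.
set rho := spectral_radius A in ymax *.
case=> _ [x Ax xr]; pose r i := complex.Re (x i); pose n i := `|r i|.
have rE i : (r i)%:C = x i by rewrite RRe_real.
have n_ge0 i : 0 <= n i := normr_ge0 _.
have slice_r i : tensor_slice real_entry r i = - rho * r i ^+ m.
  apply: (fmorph_inj (real_complex R)); rewrite /= -real_tensor_slice.
  rewrite rmorphM rmorphXn rmorphN /= rE -(eigenpair_slice _ m_gt0 Ax).
  by apply: eq_bigr => t _; under eq_bigr do rewrite rE.
have slice_le i : rho * n i ^+ m <= tensor_slice real_entry n i.
  rewrite -normrX (le_trans (ler_wpM2r (normr_ge0 _) (ler_norm rho))) //.
  rewrite -normrM -normrN -mulNr -slice_r (le_trans (ler_norm_sum _ _ _)) //.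
  rewrite ler_sum // => t _.
  by rewrite normrM normr_prod ger0_norm ?real_entry_ge0.
have slice_n i : tensor_slice real_entry n i = rho * n i ^+ m.
  apply/eqP; rewrite -subr_eq0; apply/eqP.
  have := ymax n n_ge0.
  rewrite tensor_form_slices // mulr_sumr -subr_le0 -sumrB => le0.
  have sum0 :
      \sum_j (tensor_slice real_entry n j - rho * n j ^+ m) = 0.
    by apply/le_anti; rewrite le0 sumr_ge0 // => j _; rewrite subr_ge0.
  by apply: (psumr_eq0P _ sum0) => // j _; rewrite subr_ge0.
have n_max : maximizes real_entry rho n.
  by split=> //; rewrite tensor_form_slices // mulr_sumr; apply: eq_bigr.
have n_gt0 : forall i, 0 < n i.
  apply: maximizer_gt0 real_entry_ge0 real_entry_irreducible n_max _.
  apply/not_existsP => n0; case: Ax => /eqP []; apply/ffunP => i.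
  rewrite ffunE -rE.
  by have /negP := n0 i; rewrite negbK normr_eq0 => /eqP ->.
pose Z := [set i | r i < 0]%SET; exists Z => t i At it.
have rn j : r j = (-1) ^+ (j \in Z) * n j.
  by rewrite inE -realEsign ?num_real.
have prod_r (s : seq I) :
    \prod_(j <- s) r j = (-1) ^+ count [in Z] s * \prod_(j <- s) n j.
  elim: s => [|j s IHs]; first by rewrite !big_nil mulr1.
  by rewrite !big_cons IHs {1}rn /= exprD; ring.
have size_u : size (i :: rem i t) == m.
  by rewrite -(perm_size (perm_to_rem it)) size_tuple.
(* By symmetry the word may be taken to start with i. *)
pose v := Tuple size_u; have tv : perm_eq t v := perm_to_rem it.
(* Up to the sign of x_i^m, the slice of x is minus that of n. *)
have cancel : \sum_(w : m.-tuple I | ohead w == Some i)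
    real_entry w * \prod_(j <- w) n j *
      (1 + (-1) ^+ ((i \in Z) * m + count [in Z] w)) = 0.
  transitivity (tensor_slice real_entry n i +
      (-1) ^+ ((i \in Z) * m) * tensor_slice real_entry r i).
    rewrite /tensor_slice mulr_sumr -big_split; apply: eq_bigr => w _ /=.
    by rewrite prod_r exprD; ring.
  rewrite slice_n slice_r rn exprMn -exprM mulrCA [X in _ + _ * X]mulrA -exprD.
  by rewrite addnn -mul2n exprM sqrrN !expr1n mul1r mulNr subrr.
have cancel_v := psumr_eq0P _ cancel.
have /eqP : real_entry v * \prod_(j <- v) n j *
    (1 + (-1) ^+ ((i \in Z) * m + count [in Z] v)) = 0.
  apply: cancel_v => [w _|]; last exact: eqxx.
  rewrite mulr_ge0 ?mulr_ge0 ?real_entry_ge0 ?prodr_ge0 //.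
  by rewrite -signr_odd; case: odd; rewrite ?expr1 ?subrr ?expr0 ?addr_ge0.
have av : real_entry v != 0.
  by apply: contraNneq At => v0; rewrite (A_sym tv) -real_entryE v0.
have pv : \prod_(j <- v) n j != 0.
  by rewrite gt_eqF // prodr_gt0.
rewrite (seq.permP tv) !mulf_eq0 (negPf av) (negPf pv) !orFb.
rewrite -signr_odd oddD oddM oddb.
by case: (_ && _); case: (odd (count _ v)) => //=;
  rewrite ?expr1 ?expr0 ?(pnatr_eq0 R 2).
Qed.

End Nonnegative.

(** * Adjacency tensors of hypergraphs *)

Section Adjacency.
Variables (R : realType) (V : finType) (G : hypergraph V).
Let A := adjacency_tensor R G.
Let k := rank G.
Implicit Types (e : {set V}) (Z : {set V}).

(** The multiset that the adjacency tensor attaches to the edge [e] and the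
    repeated vertex [j]; for an edge of cardinality [k] it is [e] itself,
    whatever [j]. *)
Definition edge_word e (j : V) : seq V :=
  nseq (k - #|e|).+1 j ++ enum (e :\ j)%SET.

Lemma card_edge_gt0 e : e \in edges G -> (0 < #|e|)%N.
Proof.
by move=> eG; rewrite card_gt0; apply: contraNneq (edges_nonempty G) => <-.
Qed.

Lemma card_edge_le_rank e : e \in edges G -> (#|e| <= k)%N.
Proof.
move=> eG.
exact: (leq_bigmax_cond (P := mem (edges G)) (F := fun e => #|e|)).
Qed.

Lemma edge_word_perm_eq e j :
  j \in e -> perm_eq (edge_word e j) (nseq (k - #|e|) j ++ enum e).
Proof.
move=> je; rewrite /edge_word -addn1 nseqD -catA perm_cat2l /= perm_sym.
apply: uniq_perm; rewrite /= ?enum_uniq ?andbT ?mem_enum ?inE ?eqxx // => i.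
by rewrite in_cons !mem_enum !inE; case: eqP => [->|].
Qed.

Lemma count_edge_word Z e j : j \in e ->
  count [in Z] (edge_word e j) = ((j \in Z) * (k - #|e|) + #|e :&: Z|)%N.
Proof.
move=> je; rewrite (seq.permP (edge_word_perm_eq je)) count_cat count_nseq.
congr (_ + _)%N; rewrite -sum1_count big_enum_cond -sum1_card.
by apply: eq_bigl => i; rewrite inE.
Qed.

Lemma mem_edge_word e j i : j \in e -> (i \in edge_word e j) = (i \in e).
Proof.
move=> je; rewrite (perm_mem (edge_word_perm_eq je)) mem_cat mem_enum.
by rewrite mem_nseq; case: eqP => [->|]; rewrite ?je ?orbT ?andbF.
Qed.

Lemma adjacency_tensor_ge0 t : 0 <= A t.
Proof.
by rewrite /A ffunE /=; do ?case: ifP => _; rewrite ?lexx // divr_ge0 ?ler01.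
Qed.

Lemma adjacency_tensor_perm : perm_invariant A.
Proof.
move=> t u tu; rewrite /A !ffunE /=.
have -> : [set v in tval t]%SET = [set v in tval u]%SET.
  by apply/setP => v; rewrite !inE (perm_mem tu).
case: ifP => // _; case: ifP => // _.
apply: (congr1 (fun b : bool => if b then _ else _)).
by apply: eq_existsb => j; rewrite (permPl tu).
Qed.

(** A word of length [k] whose letters form an edge of cardinality [k] has no
    repetition, so the edges of full cardinality obey the same description as
    the smaller ones. *)
Lemma adjacency_tensor_neq0 (t : k.-tuple V) :
  A t != 0 <->
  exists e j, [/\ e \in edges G, j \in e & perm_eq t (edge_word e j)].
Proof.
rewrite /A ffunE /= -/k; set e := [set v in tval t]%SET; split.
  case: ifP => [_|/negbFE eG]; first by rewrite eqxx.
  have [j je] : exists j, j \in e.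
    by apply/set0Pn; rewrite -card_gt0 card_edge_gt0.
  case: ifP => [/eqP sk _|_].
    exists e, j; split => //; rewrite perm_sym (permPl (edge_word_perm_eq je)).
    rewrite sk subnn /=; apply: uniq_perm; rewrite ?enum_uniq //.
      apply/card_uniqP; rewrite size_tuple -[RHS]sk.
      by apply: eq_card => i; rewrite inE.
    by move=> i; rewrite mem_enum inE.
  case: ifP => [/existsP[i /andP[ie ti]] _|]; last by rewrite eqxx.
  by exists e, i.
case=> f [j [fG jf tf]].
have ef : e = f by apply/setP => i; rewrite inE (perm_mem tf) mem_edge_word.
rewrite ef fG /=; case: ifP => _.
  by rewrite mul1r invr_eq0 pnatr_eq0 -lt0n fact_gt0.
rewrite ifT; last by apply/existsP; exists j; rewrite jf.
by rewrite mulf_neq0 ?invr_eq0 ?pnatr_eq0 -?lt0n ?fact_gt0.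
Qed.

Lemma edge_word_entry e j : e \in edges G -> j \in e ->
  exists2 t : k.-tuple V, tval t = edge_word e j & A t != 0.
Proof.
move=> eG je.
have sz : size (edge_word e j) == k.
  rewrite (perm_size (edge_word_perm_eq je)) size_cat size_nseq -cardE.
  by rewrite subnK // card_edge_le_rank.
by exists (Tuple sz) => //; apply/adjacency_tensor_neq0; exists e, j.
Qed.

Lemma walk_crosses (u : V) p Z : walk G u p -> u \in Z ->
  last u (unzip2 p) \notin Z ->
  exists e, [/\ e \in edges G, exists2 v, v \in e & v \in Z &
                exists2 v, v \in e & v \notin Z].
Proof.
elim: p u => [|[e v] p IHp] u /=; first by move=> _ ->.
case/and4P=> eG ue ve wp uZ lZ.
have [vZ|vZ] := boolP (v \in Z); first exact: IHp wp vZ lZ.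
by exists e; split => //; [exists u | exists v].
Qed.

(** A path leaving [Z] has an edge that crosses the boundary of [Z]. *)
Lemma adjacency_tensor_irreducible : connected G -> weakly_irreducible A.
Proof.
move=> Gconn Z [u uZ] [v vZ]; have [p /and3P[wp _ _] lp] := Gconn u v.
have [|e [eG [i ie iZ] [j je jZ]]] := walk_crosses wp uZ; first by rewrite lp.
have [t tE At] := edge_word_entry eG je; exists t => //; rewrite tE.
apply/andP; split; first by apply/hasP; exists i; rewrite ?mem_edge_word.
by apply/allPn; exists j; rewrite ?mem_edge_word.
Qed.

Lemma rank_gt0 : (0 < k)%N.
Proof.
have /set0Pn[e eG] := has_edge G.
exact: leq_trans (card_edge_gt0 eG) (card_edge_le_rank eG).
Qed.

Lemma card_setI_split (Z Z' e : {set V}) : Z :|: Z' = [set: V]%SET ->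
  [disjoint Z & Z'] -> #|e| = (#|e :&: Z| + #|e :&: Z'|)%N.
Proof.
move=> cover disj; rewrite -cardsUI -finset.setIUr cover finset.setIT.
rewrite finset.setIACA finset.setIid.
by move: disj; rewrite -setI_eq0 => /eqP ->; rewrite finset.setI0 cards0 addn0.
Qed.

(** Every edge is the union of two odd parts, hence even; so are the rank, a
    maximum of cardinalities of edges, and the number of repetitions, and only
    the odd intersection of the edge with [V1] matters. *)
Lemma odd_bipartite_skew_signing :
  odd_bipartite G -> exists Z, skew_signing A Z.
Proof.
case=> V1 [V2 [cover disj odd12]].
have even_edge e : e \in edges G -> ~~ odd #|e|.
  by move=> /odd12[o1 o2]; rewrite (card_setI_split e cover disj) oddD o1 o2.
have even_rank : ~~ odd k.
  apply: (big_ind (fun n => ~~ odd n)) => // x y x0 y0.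
  by rewrite /maxn; case: ifP.
exists V1 => t i /adjacency_tensor_neq0[e [j [eG je te]]] _.
rewrite (seq.permP te) count_edge_word // oddD oddM oddB ?card_edge_le_rank //.
by rewrite (negPf even_rank) (negPf (even_edge e eG)) !andbF (odd12 e eG).1.
Qed.

(** No edge lies in [Z] or in its complement, because then all letters of a word
    would have the same sign c, giving c^k = - c^k.  Comparing vertices of an
    edge on both sides of [Z], as first letter and as repeated letter, shows
    that [k] and the number of repetitions are even, so that the edge is even
    and its intersection with [Z] is odd. *)
Lemma skew_signing_odd_bipartite :
  (exists Z, skew_signing A Z) -> odd_bipartite G.
Proof.
case=> Z Zskew; exists Z, (~: Z)%SET; split.
- exact: finset.setUCr.
- by rewrite -setI_eq0 finset.setICr.
move=> e eG.
have sE : #|e| = (#|e :&: Z| + #|e :&: ~: Z|)%N.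
  by apply: card_setI_split; rewrite ?finset.setUCr // -setI_eq0 finset.setICr.
have parity i j : i \in e -> j \in e ->
    odd ((j \in Z) * (k - #|e|) + #|e :&: Z|) = ~~ ((i \in Z) && odd k).
  move=> ie je; have [t tE At] := edge_word_entry eG je.
  by rewrite -count_edge_word // -tE; apply: Zskew; rewrite // tE mem_edge_word.
have le_k := card_edge_le_rank eG.
have [eZ|eZ] := set_0Vmem (e :&: Z).
  have /card_gt0P[i ie] := card_edge_gt0 eG; have := parity i i ie ie.
  have iZ : i \notin Z.
    by apply/negP => iZ; have := finset.in_set0 i; rewrite -eZ inE ie iZ.
  by rewrite eZ cards0 (negPf iZ).
have [eZ'|eZ'] := set_0Vmem (e :&: ~: Z).
  case: eZ => i; rewrite inE => /andP[ie iZ]; have := parity i i ie ie.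
  move: sE; rewrite eZ' cards0 addn0 => <-.
  by rewrite iZ mul1n subnK //; case: odd.
case: eZ => i; rewrite inE => /andP[ie iZ].
case: eZ' => j; rewrite !inE => /andP[je /negPf jZ].
have := parity j j je je; have := parity i i ie ie; have := parity j i je ie.
rewrite iZ jZ mul1n mul0n add0n /= oddD oddB //.
move: sE => /(congr1 odd); rewrite oddD => ->.
by case: (odd k); case: odd; case: odd.
Qed.

End Adjacency.

Unset Implicit Arguments.

Theorem theorem3p7 (R : realType) (V : finType) (G : hypergraph V)
    (Gconn : connected G) :
  let A := adjacency_tensor R G in
  [<-> odd_bipartite G;
       spectrum A = spectrum (- A) /\ Hspectrum A = Hspectrum (- A);
       Hspectrum A (- (spectral_radius A)%:C)].
Proof.
move=> A.
have A_ge0 := @adjacency_tensor_ge0 R V G.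
have A_sym := @adjacency_tensor_perm R V G.
have A_irr := adjacency_tensor_irreducible R Gconn.
have k_gt0 := rank_gt0 G.
have [e eG] := set0Pn _ (has_edge G).
have /card_gt0P[i0 _] := card_edge_gt0 eG.
tfae.
- by case/(odd_bipartite_skew_signing R) => Z; exact: skew_signing_spectrum.
- case=> _ HspecN.
  have : Hspectrum (- A) (spectral_radius A)%:C.
    rewrite -HspecN.
    by case: (spectral_radius_maximum k_gt0 A_ge0 A_sym A_irr i0).
  case=> rho_real [x /eigenpair_opp Ax x_real].
  by split; [rewrite rpredN; exact: rho_real | exists x].
- move/(skew_signing_of_Hspectrum k_gt0 A_ge0 A_sym A_irr i0).
  exact: skew_signing_odd_bipartite.
Qed.
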